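(* Let $(X_t)_{t\ge 0}$ be a one-dimensional Feller process with symbol $p(x,\xi)$ satisfying the following condition: $C_c^\infty(\mathbb R)$ is contained in the domain of the infinitesimal generator; $x\mapsto p(x,\xi)$ is continuous and there is no diffusion part, i.e. $\sigma^2\equiv 0$; and there is $c_0\in(0,\infty)$ such that $|\operatorname{Im} p(x,\xi)|\le c_0\operatorname{Re} p(x,\xi)$ for all $x,\xi\in\mathbb R$. Put $p^{\mathsf U}(x,\xi):=\int_{y\neq 0}\min\{|\xi y|^2,1\}\,\nu(x,dy)$. If $v(x,t)\ge 0$ is a function such that $t\mapsto v(x,t)$ is monotone increasing for every $x$ and $$\int_{0+}\ \sup_{|y-x|\le v(x,t)}p^{\mathsf U}\big(y,\tfrac{1}{v(x,t)}\big)\,dt<\infty,$$ then $$\lim_{t\to0}\frac{\sup_{s\le t}|X_s-x|}{v(x,t)}=0\qquad \mathbb P^x\text{-almost surely}.$$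
   Context: A one-dimensional Feller process is a real-valued (càdlàg) Markov process $(X_t)_{t\ge0}$ whose transition semigroup $P_tu(x)=\mathbb E^x u(X_t)$, $u\in B_b(\mathbb R)$, is a Feller semigroup: (a) $P_t$ is positivity preserving with $P_t1=1$; (b) $P_t$ maps $C_\infty(\mathbb R)=\{u\in C(\mathbb R):\lim_{|x|\to\infty}u(x)=0\}$ into itself; (c) $P_t$ is a strongly continuous contraction semigroup on $(C_\infty(\mathbb R),\|\cdot\|_\infty)$. $\mathbb P^x$ denotes the law of the process started at $X_0=x$. If $C_c^\infty(\mathbb R)$ is in the domain of the generator $A$, then $Au(x)=-\int_{\mathbb R}e^{ix\xi}\hat u(\xi)\,p(x,\xi)\,d\xi$ for $u\in C_c^\infty(\mathbb R)$, where $\hat u(\xi)=(2\pi)^{-1}\int u(x)e^{-ix\xi}dx$; the function $p:\mathbb R\times\mathbb R\to\mathbb C$ is called the symbol and has the form $$p(x,\xi)=i\,l(x)\xi+\tfrac12\sigma^2(x)\xi^2+\int_{\mathbb R\setminus\{0\}}\big(1-e^{i\xi y}+i\xi y\mathbf 1_{(0,1]}(|y|)\big)\,\nu(x,dy),$$ where for each $x$: $l(x)\in\mathbb R$, $\sigma(x)\ge0$, and $\nu(x,\cdot)$ is a measure on $\mathbb R\setminus\{0\}$ with $\int_{y\ne0}(1\wedge y^2)\,\nu(x,dy)<\infty$. The notation $\int_{0+}f(t)\,dt<\infty$ means that the integral converges at the origin, i.e. $\int_0^\epsilon f(t)\,dt<\infty$ for some $\epsilon>0$. *)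

(* Defs.v *)
From HB Require Import structures.
From mathcomp Require Import all_boot all_order all_algebra.
From mathcomp Require Import all_classical all_reals all_analysis measurable_realfun.
From mathcomp Require Import complex.
Import Order.TTheory GRing.Theory Num.Theory.
Import numFieldNormedType.Exports.
Set Implicit Arguments.
Unset Strict Implicit.
Unset Printing Implicit Defensive.
Local Open Scope classical_set_scope.
Local Open Scope ring_scope.

Section function_spaces.
Context {R : realType}.
Implicit Types u : R -> R.

Definition bounded_borel u : Prop := measurable_fun setT u /\ bounded_fun u.

Definition C_infty u : Prop :=
  [/\ continuous u, u x @[x --> +oo] --> (0 : R) & u x @[x --> -oo] --> (0 : R)].

Definition Cc_infty u : Prop :=
  (forall n x, derivable (derive1n n u) x 1) /\
  compact (closure [set x | u x != 0]).

Definition sup_norm u : \bar R := ereal_sup (range (fun x => `|u x|%:E)).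

End function_spaces.

Section semigroups.
Context {R : realType}.
Implicit Types (P : R -> (R -> R) -> (R -> R)) (u f : R -> R).

(* [P t] is meaningful for [0 <= t] and on bounded Borel functions. *)
Record feller_semigroup P : Prop := FellerSemigroup {
  fs_positive : forall (t : R) u, 0 <= t -> bounded_borel u ->
    (forall x, 0 <= u x) -> forall x, 0 <= P t u x ;
  fs_conservative : forall t : R, 0 <= t -> P t (cst 1) = cst 1 ;
  fs_C_infty : forall (t : R) u, 0 <= t -> C_infty u -> C_infty (P t u) ;
  fs_linear : forall (t a : R) u f, 0 <= t -> C_infty u -> C_infty f ->
    P t (fun x => a * u x + f x) = (fun x => a * P t u x + P t f x) ;
  fs_zero : forall u, C_infty u -> P 0 u = u ;
  fs_add : forall (s t : R) u, 0 <= s -> 0 <= t -> C_infty u ->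
    P (s + t) u = P s (P t u) ;
  fs_contraction : forall (t : R) u, 0 <= t -> C_infty u ->
    (sup_norm (P t u) <= sup_norm u)%E ;
  fs_strong_continuity : forall u, C_infty u ->
    sup_norm (P t u \- u) @[t --> 0^'+] --> 0%E }.

(* The graph of the infinitesimal generator: [u] is in the domain and is mapped
   to [f]. *)
Definition generator P u f : Prop :=
  [/\ C_infty u, C_infty f &
    sup_norm (fun x => (P t u x - u x) / t - f x) @[t --> 0^'+] --> 0%E].

Definition generator_domain P u : Prop := exists f, generator P u f.

End semigroups.

Section processes.
Context {R : realType} d {Omega : measurableType d}.
Implicit Types (X : R -> Omega -> R) (Pr : R -> probability Omega R).

Definition cadlag (f : R -> R) : Prop :=
  (forall t : R, 0 <= t -> f s @[s --> t^'+] --> f t) /\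
  (forall t : R, 0 < t -> exists l : R, f s @[s --> t^'-] --> l).

Definition natural_filtration X (t : R) : set (set Omega) :=
  <<s [set A | exists r B,
         [/\ 0 <= r <= t, measurable B & A = X r @^-1` B]] >>.

(* [X t] is meaningful for [0 <= t]; [Pr x] is the law for the start at [x]. *)
Record markov_process X Pr : Prop := MarkovProcess {
  mp_measurable : forall t : R, 0 <= t -> measurable_fun setT (X t) ;
  mp_cadlag : forall w, cadlag (X ^~ w) ;
  mp_start : forall x, Pr x [set w | X 0 w = x] = 1%E ;
  mp_kernel : forall (t : R) (B : set R), 0 <= t -> measurable B ->
    measurable_fun setT (fun x => Pr x (X t @^-1` B)) ;
  mp_markov : forall (x s t : R) (A : set Omega) (B : set R),
    0 <= s -> 0 <= t -> natural_filtration X s A -> measurable B ->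
    Pr x (A `&` X (s + t) @^-1` B) =
    (\int[Pr x]_(w in A) Pr (X s w) (X t @^-1` B))%E }.

Definition transition X Pr (t : R) (u : R -> R) (x : R) : R :=
  \int[Pr x]_w u (X t w).

Definition feller_process X Pr : Prop :=
  markov_process X Pr /\ feller_semigroup (transition X Pr).

End processes.

Section symbols.
Context {R : realType}.

Definition expi (t : R) : R[i] := (cos t +i* sin t)%C.

(* Componentwise integral; it is meaningful for absolutely integrable [f]. *)
Definition Cintegral d (T : measurableType d) (mu : {measure set T -> \bar R})
    (D : set T) (f : T -> R[i]) : R[i] :=
  ((\int[mu]_(x in D) complex.Re (f x)) +i*
   (\int[mu]_(x in D) complex.Im (f x)))%C.

Definition fourier (u : R -> R) (xi : R) : R[i] :=
  ((2 * pi)^-1)%:C%C *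
  Cintegral lebesgue_measure setT (fun x => (u x)%:C%C * expi (- (x * xi))).

Definition is_symbol (P : R -> (R -> R) -> (R -> R)) (p : R -> R -> R[i]) :
    Prop :=
  forall u f, Cc_infty u -> generator P u f -> forall x,
    (f x)%:C%C = - Cintegral lebesgue_measure setT
      (fun xi => expi (x * xi) * fourier u xi * p x xi).

(* A measure on R \ {0} is given as a measure on R that is only ever used
   on [[set~ 0]]. *)
Definition levy_measure (nu : {measure set R -> \bar R}) : Prop :=
  (\int[nu]_(y in [set~ 0%R]) (Num.min 1 (y ^+ 2))%:E < +oo)%E.

Definition levy_khintchine (l sigma : R) (nu : {measure set R -> \bar R})
    (xi : R) : R[i] :=
  'i%C * (l * xi)%:C%C + (2^-1 * sigma ^+ 2 * xi ^+ 2)%:C%C +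
  Cintegral nu [set~ 0] (fun y =>
    1 - expi (xi * y) + 'i%C * (xi * y * \1_(`]0, 1]) `|y|)%:C%C).

Definition pU (nu : R -> {measure set R -> \bar R}) (x xi : R) : \bar R :=
  (\int[nu x]_(y in [set~ 0%R]) (Num.min (`|xi * y| ^+ 2) 1)%:E)%E.

Definition integrable_at_0 (f : R -> \bar R) : Prop :=
  exists2 e : R, 0 < e &
    (\int[lebesgue_measure]_(t in `]0%R, e[) f t < +oo)%E.

End symbols.

(* Main.v *)
(** Write M_t for the supremum over s <= t of |X_s - x|.  The maximal inequality
    P^x(M_t > r) <= C t sup_{|y-x| <= r} p^U(y, 1/r) is applied at the dyadic
    times t_n = e / 2^n with r = eps v(x, t_{n+1}).  As v is monotone, the n-th
    probability is at most C t_n / eps^2 times the integrand at any point of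
    ]t_{n+2}, t_{n+1}], so the probabilities are summable, and Borel-Cantelli
    gives M_t <= eps v(x, t) for all small t, for every eps.

    For the maximal inequality, let u be a smooth bump supported in the ball of
    radius r about x with u(x) = 1.  Along the grid of mesh h = t / 2^m, the
    Markov property bounds the probability of a visit outside the ball by
    2^m sup_{|y-x| <= r} (u - P_h u)(y), which tends to t sup (- A u); letting
    m tend to infinity, right continuity of the paths replaces optional stopping.
    Finally |A u(y)| <= C p^U(y, 1/r) follows from the symbol, the sector
    condition and the decay of the Fourier transform of u. *)

Require Import Defs.
From HB Require Import structures.
From mathcomp Require Import all_boot all_order all_algebra.
From mathcomp Require Import all_classical all_reals all_analysis measurable_realfun.
From mathcomp Require Import complex ring lra.
Import Order.TTheory GRing.Theory Num.Theory.
Import numFieldNormedType.Exports.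
Set Implicit Arguments.
Unset Strict Implicit.
Unset Printing Implicit Defensive.
Local Open Scope classical_set_scope.
Local Open Scope ring_scope.

(** * Integrals of functions that need not be measurable *)

(* The integral of a nonnegative function is a supremum over the simple functions
   below it, hence monotone whether or not the functions are measurable. *)
Section lower_integral.
Context d (T : measurableType d) (R : realType).
Variable mu : {measure set T -> \bar R}.
Local Open Scope ereal_scope.
Import HBNNSimple.

Lemma ge0_le_lower_integral (D : set T) (f g : T -> \bar R) :
  (forall t, D t -> 0 <= f t) -> (forall t, D t -> f t <= g t) ->
  \int[mu]_(t in D) f t <= \int[mu]_(t in D) g t.
Proof.
move=> f0 fg; rewrite !ge0_integralE //; last first.
  by move=> t Dt; exact: le_trans (f0 _ Dt) (fg _ Dt).
apply: le_ereal_sup => _ [h hf <-]; exists h => // t.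
apply: le_trans (hf t) _.
by rewrite /patch; case: ifPn => // /set_mem; exact: fg.
Qed.

(** The positive and negative parts of [f] both lie between 0 and [g], so their integrals both lie
    in [0, b], where b is the integral of [g], and the difference of two such numbers is at most b
    in absolute value. Neither function has to be measurable. *)
Lemma normr_Rintegral_le (D : set T) (f g : T -> R) :
  (forall t, D t -> (`|f t| <= g t)%R) ->
  \int[mu]_(t in D) (g t)%:E < +oo ->
  (`|\int[mu]_(t in D) f t| <= \int[mu]_(t in D) g t)%R.
Proof.
move=> fg goo.
have part_le (h : T -> \bar R) : (forall t, D t -> 0 <= h t) ->
    (forall t, D t -> h t <= `|(f t)%:E|) ->
  exists2 a : R, (0 <= a <= \int[mu]_(t in D) g t)%R &
    \int[mu]_(t in D) h t = a%:E.
  move=> h0 hf; have hg : \int[mu]_(t in D) h t <= \int[mu]_(t in D) (g t)%:E.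
    apply: ge0_le_lower_integral => // t Dt.
    by apply: le_trans (hf _ Dt) _; rewrite lee_fin fg.
  have hfin : \int[mu]_(t in D) h t \is a fin_num.
    by rewrite ge0_fin_numE ?integral_ge0 //; exact: le_lt_trans hg goo.
  exists (fine (\int[mu]_(t in D) h t)); last by rewrite fineK.
  rewrite fine_ge0 ?integral_ge0 //= fine_le // ge0_fin_numE //.
  by apply: le_trans hg; exact: integral_ge0.
rewrite /Rintegral integralE.
have [t _||a /andP[a0 ag] ->] := part_le ((EFin \o f)^\+).
- exact: funepos_ge0.
- by move=> t _; rewrite funeposE /= ge_max !lee_fin normr_ge0 ler_norm /=.
have [t _||b /andP[b0 bg] ->] := part_le ((EFin \o f)^\-).
- exact: funeneg_ge0.
- by move=> t _; rewrite funenegE /= ge_max !lee_fin normr_ge0 -normrN ler_norm /=.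
rewrite -EFinB /= ler_norml; apply/andP; split; move: ag bg; rewrite /Rintegral; lra.
Qed.

End lower_integral.

(** The integrand is even with antiderivative [atan (r * xi)]. Since the value does not depend on
    [r], the bound on the generator will have a constant uniform in the radius. *)
Lemma integral_oneDsqr_scale (R : realType) (r : R) : 0 < r ->
  (\int[lebesgue_measure]_xi (r / (1 + (r * xi) ^+ 2))%:E = pi%:E)%E.
Proof.
move=> r0; pose g (xi : R) := r / (1 + (r * xi) ^+ 2).
have den (z : R) : 0 < 1 + (r * z) ^+ 2 by rewrite ltr_pwDl ?sqr_ge0.
have cg : continuous g.
  move=> z; apply: cvgM; first exact: cvg_cst.
  apply: cvgV; first by rewrite gt_eqF.
  apply: cvgD; first exact: cvg_cst.
  by apply: (@continuous_comp _ _ _ (fun y : R => r * y) (fun y : R => y ^+ 2));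
    [exact: mulrl_continuous | exact: exprn_continuous].
have dF (z : R) : is_derive z 1 (fun z : R => atan (r * z)) (g z).
  rewrite (_ : (fun _ => _) = atan \o (r \*: id)) //.
  by apply: is_derive_eq; rewrite /g /= /GRing.scale /= mulr1 mulrC.
rewrite (@ge0_symfun_integralT R g) //; last 2 first.
- by move=> z; rewrite divr_ge0 ?ltW.
- by move=> z; rewrite /g /= mulrN sqrrN.
have cF : continuous (fun z : R => atan (r * z)).
  by move=> z; apply: differentiable_continuous; apply/derivable1_diffP; exact: ex_derive.
rewrite -set_itvcy (@ge0_continuous_FTC2y R g (fun z => atan (r * z)) 0 (pi / 2)).
- by rewrite mulr0 atan0 sube0 -EFinM mulrC divfK.
- by move=> z _; rewrite divr_ge0 ?ltW.
- exact: continuous_subspaceT.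
- apply: (@cvg_comp _ _ _ (fun z => r * z) atan); last exact: cvgy_atan.
  exact: gt0_cvgMry.
- by move=> z _; exact: ex_derive.
- by apply: cvg_at_right_filter; exact: cF.
- by move=> z _; rewrite derive1E; exact: derive_val.
Qed.

(** * A smooth bump and the decay of its Fourier transform *)

Section bump.
Variable R : realType.
Implicit Types (q : {poly R}) (k : nat) (x y z : R).

Let invw x : R := (1 - x ^+ 2)^-1.

(* The derivatives of the bump function [bump_term 1 0] stay in this family. *)
Definition bump_term q k x : R :=
  if `|x| < 1 then q.[x] * invw x ^+ k * expR (1 - invw x) else 0.

(** Numerator of the derivative of q w^(-k) exp(1 - 1/w), with w = 1 - x^2, over the common
    denominator w^(k+2). The three terms come from [q], from the power and from the exponential. *)
Definition bump_deriv q k : {poly R} :=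
  q^`() * (1 - 'X^2) ^+ 2 + (2 * k%:R) *: (q * 'X * (1 - 'X^2)) - 2 *: (q * 'X).

Let w_gt0 x : `|x| < 1 -> 0 < 1 - x ^+ 2.
Proof. by rewrite ltr_norml => /andP[x1 x2]; nra. Qed.

Lemma bump_term_eq0 q k x : 1 <= `|x| -> bump_term q k x = 0.
Proof. by rewrite /bump_term ltNge => ->. Qed.

Let is_derive_sqr0 (f : R -> R) (C a : R) : f a = 0 ->
  (forall y, `|f y| <= C * (y - a) ^+ 2) -> is_derive a 1 f 0.
Proof.
move=> fa fC; have C0 : 0 <= C.
  by have := fC (a + 1); rewrite addrAC subrr add0r expr1n mulr1; apply: le_trans.
suff cv : h^-1 *: ((f \o shift a) (h *: (1 : R)) - f a) @[h --> 0^'] --> (0 : R).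
  by split; [apply/cvg_ex; exists 0 | exact/cvg_lim].
apply/cvgr0Pnorm_le => e e0; near=> h.
have h0 : h != 0 by near: h; exact: nbhs_dnbhs_neq.
rewrite fa subr0 /= normrZ normfV /GRing.scale /= mulr1.
rewrite ler_pdivrMl ?normr_gt0 //; apply: le_trans (fC _) _.
rewrite addrK -real_normK ?num_real // expr2 mulrCA ler_pM2l ?normr_gt0 //.
have : `|h| <= e / (C + 1).
  by near: h; apply: dnbhs0_le; rewrite divr_gt0 // ltr_pwDr.
rewrite ler_pdivlMr ?ltr_pwDr // => /(le_trans _); apply.
by rewrite mulrC ler_wpM2l // lerDl.
Unshelve. all: by end_near. Qed.

Let horner_bounded q : exists2 B : R, 0 <= B & forall x, `|x| < 1 -> `|q.[x]| <= B.
Proof.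
exists (\sum_(i < size q) `|q`_i|); first exact: sumr_ge0.
move=> x x1; rewrite horner_coef; apply: le_trans (ler_norm_sum _ _ _) _.
apply: ler_sum => i _; rewrite normrM normrX ler_piMr //.
by apply: exprn_ile1 => //; exact: ltW.
Qed.

(** A single term x^k / k! of the exponential series is at most [expR x]. *)
Let powexp k x : 0 <= x -> x ^+ k * expR (1 - x) <= expR 1 * k`!%:R.
Proof.
move=> x0; rewrite expRD mulrCA ler_pM2l ?expR_gt0 // expRN.
rewrite ler_pdivrMr ?expR_gt0 // -ler_pdivrMl ?ltr0n ?fact_gt0 // mulrC.
case: k => [|k]; first by rewrite fact0 expr0 divr1 -expR0 ler_expR.
by apply: le_trans (expR_ge1Dxn k x0); rewrite lerDr.
Qed.

(* Flatness of order two at the boundary of the unit ball is all that is needed to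
   differentiate the extension by zero. *)
Lemma bump_term_flat q k : exists2 C : R, 0 <= C &
  forall x, `|bump_term q k x| <= C * (if `|x| < 1 then 1 - x ^+ 2 else 0) ^+ 2.
Proof.
have [B B0 qB] := horner_bounded q.
(* Two further powers of [invw x] pay for the factor (1 - x^2)^2, so [powexp] is used with exponent
   [k.+2]. *)
exists (B * (expR 1 * k.+2`!%:R)); first by rewrite !mulr_ge0 ?expR_ge0.
move=> x; rewrite /bump_term; case: ifPn => [x1|_]; last first.
  by rewrite normr0 expr0n mulr0.
have w0 := w_gt0 x1; have i0 : 0 < invw x by rewrite invr_gt0.
rewrite !normrM -!mulrA ler_pM //; first exact: qB.
rewrite [`|invw x ^+ k|]ger0_norm; last exact/exprn_ge0/ltW.
rewrite ger0_norm ?expR_ge0 //.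
have iw : invw x * (1 - x ^+ 2) = 1 by rewrite mulVf ?gt_eqF.
have -> : invw x ^+ k = invw x ^+ k.+2 * (1 - x ^+ 2) ^+ 2.
  by rewrite -addn2 exprD -mulrA -exprMn iw expr1n mulr1.
rewrite mulrAC mulrA ler_wpM2r ?sqr_ge0 //.
exact: powexp (ltW i0).
Qed.

Lemma bump_term_bounded q k : exists2 C : R, 0 <= C & forall x, `|bump_term q k x| <= C.
Proof.
have [C C0 Cq] := bump_term_flat q k; exists C => // x.
apply: le_trans (Cq x) _; rewrite ler_piMr // exprn_ile1 //; case: ifPn => //= x1.
  by rewrite ltW // w_gt0.
by rewrite lerBlDr lerDl sqr_ge0.
Qed.

Lemma is_derive_bump_term q k x :
  is_derive x 1 (bump_term q k) (bump_term (bump_deriv q k) k.+2 x).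
Proof.
have [x1|x1] := ltP `|x| 1; last first.
  rewrite bump_term_eq0 //.
  have [C C0 Cq] := bump_term_flat q k.
  (* The 4 is the square of the 2 in 1 - y^2 <= 2 (1 - |y|) <= 2 |y - x|, valid for |y| < 1 <=
     |x|. *)
  apply: (@is_derive_sqr0 _ (C * 4)); first exact: bump_term_eq0.
  move=> y; apply: le_trans (Cq y) _; rewrite -mulrA ler_wpM2l //.
  case: ltP => [y1|_]; last by rewrite expr0n mulr_ge0 ?sqr_ge0.
  have w0 := w_gt0 y1.
  have yx : 1 - `|y| <= `|y - x|.
    rewrite distrC; apply: le_trans (lerB_dist _ _); exact: lerB.
  have : 1 - y ^+ 2 <= 2 * `|y - x|.
    have := normr_ge0 y; have := real_normK (num_real y) => <-; nra.
  rewrite -[(y - x) ^+ 2]real_normK ?num_real // => h.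
  have -> : 4 * `|y - x| ^+ 2 = (2 * `|y - x|) ^+ 2 by ring.
  by rewrite lerXn2r // ?nnegrE ?mulr_ge0 // ltW.
have w0 := w_gt0 x1.
have d1 : is_derive x 1 invw (2 * x * invw x ^+ 2).
  rewrite (_ : invw = fun y => ((1 - 'X^2 : {poly R}).[y])^-1); last first.
    by apply/funext => y; rewrite !hornerE.
  have h0 : (1 - 'X^2 : {poly R}).[x] != 0 by rewrite !hornerE gt_eqF.
  have dw : (1 - 'X^2 : {poly R})^`() = - ('X *+ 2).
    by rewrite derivB derivXn -polyC1 derivC sub0r.
  apply: is_derive_eq; rewrite dw !hornerE /GRing.scale /=.
  by field; rewrite gt_eqF.
apply: (@near_eq_is_derive _ _ _
    (horner q * (invw ^+ k) * (expR \o (cst 1 - invw)))).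
  have : \forall y \near x, `|y| < 1.
    exact: (@cvgr_norm_lt _ _ _ _ _ id x cvg_id _ x1).
  by apply: filterS => y y1; rewrite /bump_term y1 /= !fctE.
have -> : bump_term (bump_deriv q k) k.+2 x =
    (bump_deriv q k).[x] * (invw x ^+ k * invw x ^+ 2) * expR (1 - invw x).
  by rewrite /bump_term x1 -exprD addn2.
apply: is_derive_eq; rewrite !fctE /GRing.scale /= /bump_deriv !hornerE.
have -> : (1 - x ^+ 2) = (invw x)^-1 by rewrite invrK.
have i0 : invw x != 0 by rewrite invr_eq0 gt_eqF.
(* Differentiating the power lowers its exponent, so exponent 0 is treated apart. *)
case: k => [|k]; first by rewrite !expr0 /=; field.
rewrite exprS /=; move: (invw x ^+ k) => P; field; exact: i0.
Qed.

Definition bump_derivn n : {poly R} * nat :=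
  iter n (fun qk => (bump_deriv qk.1 qk.2, qk.2.+2)) (1, 0%N).

(** The index [n] counts derivatives in [y] (see [derive1n_bump]), and the chain rule produces
    [r^-1 ^+ n]. With z = (y - a) / r, [bump a r 0] is exp(1 - 1/(1 - z^2)) for |z| < 1, normalised
    to 1 at the centre. *)
Definition bump (a r : R) n y : R :=
  r^-1 ^+ n * bump_term (bump_derivn n).1 (bump_derivn n).2 ((y - a) / r).

Section scaled.
Variables (a r : R).
Hypothesis r0 : 0 < r.

Lemma is_derive_bump n y : is_derive y 1 (bump a r n) (bump a r n.+1 y).
Proof.
pose g := r^-1 \*: (id - cst a : R -> R).
rewrite (_ : bump a r n = r^-1 ^+ n \*:
  (bump_term (bump_derivn n).1 (bump_derivn n).2 \o g)); last first.
  by apply/funext => z; rewrite /g !fctE /= /bump [X in bump_term _ _ X]mulrC.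
have dg : is_derive y 1 g r^-1 by apply: is_derive_eq; rewrite subr0 /GRing.scale /= mulr1.
have db := is_derive_bump_term (bump_derivn n).1 (bump_derivn n).2 (g y).
apply: is_derive_eq.
rewrite /bump /g !fctE /= /GRing.scale /= [(y - a) / r]mulrC exprS; ring.
Qed.

Lemma derive1n_bump n : derive1n n (bump a r 0) = bump a r n.
Proof.
elim: n => [|n IH]; first by rewrite derive1n0.
rewrite derive1nS IH; apply/funext => y; rewrite derive1E.
exact: (derive_val (is_derive := is_derive_bump n y)).
Qed.

Lemma derivable_bump n y : derivable (bump a r n) y 1.
Proof. exact: (ex_derive (is_derive := is_derive_bump n y)). Qed.

Lemma continuous_bump n : continuous (bump a r n).
Proof.
move=> y; apply: differentiable_continuous; apply/derivable1_diffP.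
exact: derivable_bump.
Qed.

Lemma bump_eq0 n y : r <= `|y - a| -> bump a r n y = 0.
Proof.
move=> ry; rewrite /bump bump_term_eq0 ?mulr0 //.
by rewrite normf_div (gtr0_norm r0) ler_pdivlMr // mul1r.
Qed.

Lemma Cc_infty_bump : Cc_infty (bump a r 0).
Proof.
split=> [n y|]; first by rewrite derive1n_bump; exact: derivable_bump.
apply: (@subclosed_compact _ _ `[a - r, a + r]).
- exact: closed_closure.
- exact: segment_compact.
- rewrite (closure_id `[a - r, a + r]).1; last exact: itv_closed.
  apply: closure_subset => y /=.
  apply: contraNP => /negP; rewrite in_itv /= -ler_distl -ltNge => yr.
  by rewrite bump_eq0 // ltW // distrC.
Qed.

Lemma bump_center : bump a r 0 a = 1.
Proof.
rewrite /bump /= expr0 mul1r subrr mul0r /bump_term normr0 ltr01 hornerC expr0.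
by rewrite /invw expr0n subr0 invr1 subrr expR0 !mulr1.
Qed.

Lemma bump_itv y : 0 <= bump a r 0 y <= 1.
Proof.
rewrite /bump /= expr0 mul1r /bump_term; case: ifPn => [x1|_]; last by rewrite lexx ler01.
rewrite hornerC expr0 !mul1r expR_ge0 -[X in _ <= X]expR0 ler_expR subr_le0.
by rewrite /invw invf_ge1 ?w_gt0 // gerBl sqr_ge0.
Qed.

End scaled.

(** One [B] serves all centres and radii; only the explicit power of [r] remains. *)
Lemma bump_bounded n : exists2 B : R, 0 <= B &
  forall a r y, 0 < r -> `|bump a r n y| <= r^-1 ^+ n * B.
Proof.
have [B B0 bB] := bump_term_bounded (bump_derivn n).1 (bump_derivn n).2.
exists B => // a r y r0; have rn : 0 <= r^-1 ^+ n by rewrite exprn_ge0 // invr_ge0 ltW.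
by rewrite /bump normrM (ger0_norm rn) ler_wpM2l.
Qed.

End bump.

Section fourier_decay.
Variable R : realType.
Local Notation mu := (@lebesgue_measure R).

Lemma Rintegral_by_parts0 (F f G g : R -> R) (a b : R) : a < b ->
  (forall y : R, is_derive y 1 F (f y)) -> (forall y : R, is_derive y 1 G (g y)) ->
  continuous f -> continuous g -> F a = 0 -> F b = 0 ->
  \int[mu]_(y in `[a, b]) (F y * g y) = - \int[mu]_(y in `[a, b]) (f y * G y).
Proof.
move=> ab dF dG cf cg Fa Fb.
have LR (H h : R -> R) : (forall y : R, is_derive y 1 H (h y)) ->
    derivable_oo_LRcontinuous H a b /\ {in `]a, b[, H^`()%classic =1 h}.
  move=> dH; have cH : continuous H.
    move=> y; apply: differentiable_continuous; apply/derivable1_diffP.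
    exact: (ex_derive (is_derive := dH y)).
  split; first split.
  - by move=> y _; exact: (ex_derive (is_derive := dH y)).
  - by apply: cvg_at_right_filter; exact: cH.
  - by apply: cvg_at_left_filter; exact: cH.
  - by move=> y _; rewrite derive1E; exact: (derive_val (is_derive := dH y)).
have [LF Ff] := LR _ _ dF; have [LG Gg] := LR _ _ dG.
rewrite (@Rintegration_by_parts R F G f g) // ?Fa ?Fb ?mul0r ?subrr ?sub0r //.
- exact: continuous_subspaceT.
- exact: continuous_subspaceT.
Qed.

Variables (a r : R).
Hypothesis r0 : 0 < r.

Let D := `[a - r, a + r]%classic.
Let ab : a - r < a + r. Proof. by rewrite ltrD2l gtrN. Qed.

Let C n xi := \int[mu]_(y in D) (bump a r n y * cos (y * xi)).
Let S n xi := \int[mu]_(y in D) (bump a r n y * sin (y * xi)).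

Let bump_l n : bump a r n (a - r) = 0.
Proof. by rewrite bump_eq0 // addrAC subrr sub0r normrN ger0_norm // ltW. Qed.
Let bump_r n : bump a r n (a + r) = 0.
Proof. by rewrite bump_eq0 // addrAC subrr add0r ger0_norm // ltW. Qed.

Let dsin (xi y : R) : is_derive y 1 (fun y : R => sin (y * xi)) (xi * cos (y * xi)).
Proof.
rewrite (_ : (fun _ => _) = sin \o (xi \*: id)); last first.
  by apply/funext => z; rewrite !fctE /= mulrC.
by apply: is_derive_eq; rewrite /= /GRing.scale /= mulr1 mulrC [y * xi]mulrC.
Qed.

Let dcos (xi y : R) : is_derive y 1 (fun y : R => - cos (y * xi)) (xi * sin (y * xi)).
Proof.
rewrite (_ : (fun _ => _) = - (cos \o (xi \*: id))); last first.
  by apply/funext => z; rewrite !fctE /= mulrC.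
apply: is_derive_eq.
by rewrite /= /GRing.scale /= mulr1 mulNr opprK mulrC [y * xi]mulrC.
Qed.

Let ccos (xi : R) : continuous (fun y : R => cos (y * xi)).
Proof.
move=> y; apply: (@continuous_comp _ _ _ (fun y : R => y * xi) cos).
  exact: mulrr_continuous.
exact: continuous_cos.
Qed.

Let csin (xi : R) : continuous (fun y : R => sin (y * xi)).
Proof.
move=> y; apply: (@continuous_comp _ _ _ (fun y : R => y * xi) sin).
  exact: mulrr_continuous.
exact: continuous_sin.
Qed.

Let scaleI (h : R -> R) n xi : continuous h ->
  \int[mu]_(y in D) (bump a r n y * (xi * h y)) =
  xi * \int[mu]_(y in D) (bump a r n y * h y).
Proof.
move=> ch; rewrite -RintegralZl //.
- by apply: eq_Rintegral => y _; rewrite mulrCA.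
- exact: measurable_itv.
- apply: (@continuous_compact_integrable R (fun y : R => bump a r n y * h y)).
    exact: segment_compact.
  by apply: continuous_subspaceT => y; apply: cvgM; [exact: continuous_bump|exact: ch].
Qed.

(* Two rounds of integration by parts through [normC] and [normS] give the factor
   [xi ^+ 4]. *)
Let normC n xi : `|xi| * `|C n xi| = `|S n.+1 xi|.
Proof.
rewrite /C -normrM -scaleI; last exact: ccos.
rewrite (Rintegral_by_parts0 ab (is_derive_bump a r n) (dsin xi)) ?normrN //.
- exact: continuous_bump.
- by move=> y; apply: cvgM; [exact: cvg_cst|exact: ccos].
Qed.

Let normS n xi : `|xi| * `|S n xi| = `|C n.+1 xi|.
Proof.
rewrite /S -normrM -scaleI; last exact: csin.
rewrite (Rintegral_by_parts0 ab (is_derive_bump a r n) (dcos xi)) //.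
- rewrite normrN -normrN /C; congr (`|_|).
  transitivity (- \int[mu]_(y in D) (bump a r n.+1 y * ((-1) * cos (y * xi)))).
    by congr (- _); apply: eq_Rintegral => y _; rewrite mulN1r.
  by rewrite scaleI ?mulN1r ?opprK //; exact: ccos.
- exact: continuous_bump.
- by move=> y; apply: cvgM; [exact: cvg_cst|exact: csin].
Qed.

Let bound n (B : R) (h : R -> R) :
  (forall y, `|bump a r n y| <= B) -> (forall y, `|h y| <= 1) ->
  `|\int[mu]_(y in D) (bump a r n y * h y)| <= 2 * r * B.
Proof.
move=> bB h1.
have B0 : 0 <= B by apply: le_trans (bB 0).
have muD : mu D = (2 * r)%:E.
  rewrite lebesgue_measure_itv /= lte_fin ab -EFinB; congr EFin; ring.
have -> : 2 * r * B = \int[mu]_(y in D) B.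
  by rewrite Rintegral_cst; [rewrite -[X in fine X]/(mu D) muD mulrC | exact: measurable_itv].
apply: normr_Rintegral_le.
  by move=> y _; rewrite normrM -[leRHS]mulr1 ler_pM.
by rewrite integral_cst; [rewrite -[X in (_ * X)%E]/(mu D) muD ltry | exact: measurable_itv].
Qed.

(** Let I be either integral and w = (r xi)^2. Trivially |I| <= 2 r, and four integrations by parts
    give w^2 |I| <= 2 r B. The claim follows from (1 + w)^2 <= 2 (1 + w^2). The fourth power is
    chosen because the symbol grows like 1 + w, so that an integrable r / (1 + w) is left over. *)
Lemma osc_bump_le (B xi : R) :
  (forall y, `|bump a r 4 y| <= r^-1 ^+ 4 * B) ->
  `|C 0 xi| <= 4 * (1 + B) * r / (1 + (r * xi) ^+ 2) ^+ 2 /\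
  `|S 0 xi| <= 4 * (1 + B) * r / (1 + (r * xi) ^+ 2) ^+ 2.
Proof.
move=> b4.
have b0 y : `|bump a r 0 y| <= 1.
  by have /andP[p0 p1] := bump_itv a r y; rewrite ger0_norm.
have key (z : R) : 0 <= z -> z <= 2 * r * 1 ->
    `|xi| ^+ 4 * z <= 2 * r * (r^-1 ^+ 4 * B) ->
    z <= 4 * (1 + B) * r / (1 + (r * xi) ^+ 2) ^+ 2.
  move=> z0 z1 z2.
  rewrite ler_pdivlMr ?exprn_gt0 ?ltr_pwDl ?sqr_ge0 //.
  have z3 : (r * xi) ^+ 4 * z <= 2 * r * B.
    have -> : (r * xi) ^+ 4 * z = r ^+ 4 * (`|xi| ^+ 4 * z).
      rewrite exprMn -mulrA; congr (_ * (_ * _)).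
      by rewrite -normrX ger0_norm // exprn_even_ge0.
    apply: le_trans (ler_wpM2l _ z2) _; first by rewrite exprn_ge0 // ltW.
    rewrite exprVn; rewrite le_eqVlt; apply/orP; left; apply/eqP; field; exact: lt0r_neq0.
  rewrite (exprM _ 2 2) in z3.
  have := sqr_ge0 (1 - (r * xi) ^+ 2); move: ((r * xi) ^+ 2) z3 => w z3 w0; nra.
split; apply: key => //.
- by apply: bound => // y; rewrite ler_norml cos_geN1 cos_le1.
- have -> : `|xi| ^+ 4 * `|C 0 xi| = `|C 4 xi|.
    by rewrite -normS -normC -normS -normC; ring.
  by apply: bound => // y; rewrite ler_norml cos_geN1 cos_le1.
- by apply: bound => // y; rewrite ler_norml sin_geN1 sin_le1.
- have -> : `|xi| ^+ 4 * `|S 0 xi| = `|S 4 xi|.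
    by rewrite -normC -normS -normC -normS; ring.
  by apply: bound => // y; rewrite ler_norml sin_geN1 sin_le1.
Qed.

End fourier_decay.

Section fourier_bump.
Variable R : realType.
Local Notation mu := (@lebesgue_measure R).

Lemma fourier_bump_le : exists2 K : R, 0 <= K & forall a r xi : R, 0 < r ->
  `|complex.Re (fourier (bump a r 0) xi)| <= K * r / (1 + (r * xi) ^+ 2) ^+ 2 /\
  `|complex.Im (fourier (bump a r 0) xi)| <= K * r / (1 + (r * xi) ^+ 2) ^+ 2.
Proof.
have [B B0 b4] := @bump_bounded R 4.
exists (4 * (1 + B)); first by rewrite mulr_ge0 ?addr_ge0.
move=> a r xi r0.
(* The kernel of [fourier] is [expi (- (x * xi))], whence the frequency [- xi]. *)
have [hC hS] := @osc_bump_le _ a r r0 B (- xi) (fun y => b4 a r y r0).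
have restr (h : R -> R) : \int[mu]_(y in `[a - r, a + r]) (bump a r 0 y * h y) =
    \int[mu]_y (bump a r 0 y * h y).
  rewrite Rintegral_mkcond; congr Rintegral; apply/funext => y.
  rewrite patchE; case: ifPn => // /negP yr; rewrite bump_eq0 ?mul0r //.
  rewrite leNgt; apply/negP => ya; apply: yr; apply/mem_set.
  by rewrite /= in_itv /= -ler_distl ltW // distrC.
rewrite !restr mulrN sqrrN in hC hS.
have pi2 : `|(2 * pi : R)^-1| <= 1.
  rewrite ger0_norm ?invr_ge0 ?mulr_ge0 ?pi_ge0 // invf_le1 ?mulr_gt0 ?pi_gt0 //.
  have := pi_ge2 R; lra.
rewrite /fourier /Cintegral /=.
split; rewrite !mul0r ?subr0 ?addr0 normrM.
- apply: le_trans hC; rewrite -[leRHS]mul1r ler_pM //.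
  rewrite le_eqVlt; apply/orP; left; apply/eqP; congr `|_|.
  by apply: eq_Rintegral => y _; rewrite mul0r subr0 mulrN.
- apply: le_trans hS; rewrite -[leRHS]mul1r ler_pM //.
  rewrite le_eqVlt; apply/orP; left; apply/eqP.
  by congr `|_|; apply: eq_Rintegral => y _; rewrite mul0r addr0 mulrN.
Qed.

End fourier_bump.

(** * The generator on bump functions *)

Lemma normr_sin_le (R : realType) (x : R) : `|sin x| <= `|x|.
Proof.
wlog x0 : x / 0 < x => [hw|].
  have [x0|x0|->] := ltgtP x 0; [|exact: hw|by rewrite sin0 normr0].
  by rewrite -(normrN x) -[leLHS]normrN -sinN hw // oppr_gt0.
have [|c _] := @MVT_segment R sin cos 0 x (ltW x0).
  by apply: continuous_subspaceT => y; exact: continuous_sin.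
rewrite sin0 !subr0 => ->; rewrite normrM ler_piMl //.
by rewrite ler_norml cos_geN1 cos_le1.
Qed.

Lemma one_sub_cos_le (R : realType) (x : R) : 1 - cos x <= x ^+ 2 / 2.
Proof.
have -> : cos x = 1 - 2 * sin (x / 2) ^+ 2.
  rewrite [in LHS](_ : x = (x / 2) *+ 2); last by rewrite -mulr_natr divfK.
  by rewrite cos_mulr2n; have := cos2Dsin2 (x / 2); lra.
have := normr_sin_le (x / 2); rewrite -ler_sqr ?nnegrE // !real_normK ?num_real //.
rewrite expr_div_n; lra.
Qed.

(** * Truncated second moments of the Lévy measure *)

Section truncated_moment.
Variable R : realType.
Implicit Types (N : {measure set R -> \bar R}) (nu : R -> {measure set R -> \bar R}).
Local Notation trunc a y := (Num.min (`|a * y| ^+ 2) 1 : R).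

Let trunc_ge0 (a y : R) : 0 <= trunc a y.
Proof. by rewrite le_min sqr_ge0 ler01. Qed.

Let measurable_trunc (D : set R) (a : R) :
  measurable_fun D (fun y : R => (trunc a y)%:E).
Proof.
apply/measurable_EFinP; apply: measurable_funTS.
apply: measurable_minr; last exact: measurable_cst.
apply: continuous_measurable_fun => y.
apply: (@continuous_comp _ _ _ (fun y : R => `|a * y|) (fun z => z ^+ 2)).
  apply: (@continuous_comp _ _ _ (fun y : R => a * y) (fun z => `|z|)).
    exact: mulrl_continuous.
  exact: norm_continuous.
exact: exprn_continuous.
Qed.

Let m0 : measurable ([set~ 0] : set R).
Proof. by apply: measurableC; exact: measurable_set1. Qed.

Lemma pU_ge0 nu x xi : (0 <= pU nu x xi)%E.
Proof. by apply: integral_ge0 => y _; rewrite lee_fin. Qed.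

Lemma pU_le_scale nu x (a b c : R) : 0 <= c ->
  (forall y, trunc a y <= c * trunc b y) ->
  (pU nu x a <= c%:E * pU nu x b)%E.
Proof.
move=> c0 h; rewrite -ge0_integralZl_EFin //.
  by apply: ge0_le_lower_integral => y _; rewrite -?EFinM lee_fin ?trunc_ge0 ?h.

Qed.

(** At frequency 1 this is the Lévy condition; the general case follows from min(xi^2 y^2, 1) <= (1
    + xi^2) min(y^2, 1). *)
Lemma pU_lt_pinfty nu x xi : levy_measure (nu x) -> (pU nu x xi < +oo)%E.
Proof.
move=> L; have h : (pU nu x 1 < +oo)%E.
  apply: le_lt_trans L; apply: ge0_le_lower_integral => y _; rewrite lee_fin //.
  by rewrite mul1r real_normK ?num_real // minC.
apply: (@le_lt_trans _ _ ((1 + xi ^+ 2)%:E * pU nu x 1)%E); last first.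
  by rewrite lte_mul_pinfty // lee_fin addr_ge0 ?sqr_ge0.
apply: pU_le_scale => [|y]; first by rewrite addr_ge0 ?sqr_ge0.
rewrite mul1r normrM exprMn !real_normK ?num_real //.
have := sqr_ge0 y; have := sqr_ge0 xi.
by move: (xi ^+ 2) (y ^+ 2) => u w u0 w0; case: (leP w 1); case: (leP (u * w) 1); nra.
Qed.

(** For u >= 1, min(u w, 1) <= u min(w, 1), here with u = e^(-2). Shrinking the radius by a fixed
    factor costs only a constant; this turns a bound on the final ratio into the limit 0. *)
Lemma pU_dilate nu x (e r : R) : 0 < e -> e <= 1 -> 0 < r ->
  (pU nu x (e * r)^-1 <= (e ^- 2)%:E * pU nu x r^-1)%E.
Proof.
move=> e0 e1 r0; apply: pU_le_scale => [|y]; first by rewrite invr_ge0 exprn_ge0 // ltW.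
have -> : (e * r)^-1 * y = e^-1 * (r^-1 * y) by field; rewrite !gt_eqF.
rewrite [in leLHS]normrM exprMn [`|e^-1|]gtr0_norm ?invr_gt0 // exprVn.
have : 1 <= e ^- 2 by rewrite invf_ge1 ?exprn_gt0 // exprn_ile1 // ltW.
have := sqr_ge0 (`|r^-1 * y|).
move: (e ^- 2) (`|r^-1 * y| ^+ 2) => u w w0 u1.
by case: (leP w 1); case: (leP (u * w) 1); nra.
Qed.

(** Drift and compensator are purely imaginary, so the real part is the integral of 1 - cos(xi y).
    This integrand is at most 2 and at most (xi y)^2 / 2, where (xi y)^2 = (r xi)^2 (y / r)^2; the
    two bounds are used for |y| > r and |y| <= r respectively. *)
Lemma Re_symbol_le (l s : R) nu x (r xi : R) : levy_measure (nu x) -> s ^+ 2 = 0 ->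
  0 < r ->
  `|complex.Re (levy_khintchine l s (nu x) xi)| <=
  2 * (1 + (r * xi) ^+ 2) * fine (pU nu x r^-1).
Proof.
move=> L s0 r0.
have c0 : 0 <= 2 * (1 + (r * xi) ^+ 2) by rewrite mulr_ge0 ?addr_ge0 ?sqr_ge0.
have intE : (\int[nu x]_(y in [set~ 0%R]) (2 * (1 + (r * xi) ^+ 2) * trunc r^-1 y)%:E =
    (2 * (1 + (r * xi) ^+ 2))%:E * pU nu x r^-1)%E.
  rewrite -ge0_integralZl_EFin //.
have pUfin : pU nu x r^-1 \is a fin_num.
  by rewrite ge0_fin_numE ?pU_ge0 // pU_lt_pinfty.
rewrite /levy_khintchine /Cintegral /= s0 !(mulr0, mul0r, mul1r, oppr0, addr0, add0r).
have -> : 2 * (1 + (r * xi) ^+ 2) * fine (pU nu x r^-1) =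
    \int[nu x]_(y in [set~ 0]) (2 * (1 + (r * xi) ^+ 2) * trunc r^-1 y).
  by rewrite /Rintegral intE fineM.
apply: normr_Rintegral_le; last by rewrite intE lte_mul_pinfty // ?lee_fin // ltey_eq pUfin.
move=> y _ /=; rewrite !(mulr0, mul0r, mul1r, oppr0, addr0, add0r).
have c1 := cos_le1 (xi * y); have c2 := cos_geN1 (xi * y).
have c3 := one_sub_cos_le (xi * y).
rewrite ger0_norm ?subr_ge0 // real_normK ?num_real //.
have E : (xi * y) ^+ 2 = (r * xi) ^+ 2 * (r^-1 * y) ^+ 2.
  by field; exact: lt0r_neq0.
have := sqr_ge0 (r * xi); have := sqr_ge0 (r^-1 * y).
move: c3; rewrite E; move: ((r * xi) ^+ 2) ((r^-1 * y) ^+ 2) => u w.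
by case: (leP w 1); nra.
Qed.

End truncated_moment.

Section generator_bump.
Variable R : realType.
Local Notation mu := (@lebesgue_measure R).

(** The decay K r / (1 + (r xi)^2)^2 of the Fourier transform meets the growth 2 (1 + (r xi)^2) of
    the symbol, leaving a multiple of r / (1 + (r xi)^2), whose integral is [pi] times that
    multiple. The sector condition bounds the imaginary part, drift included, by the real part. The
    constant depends on [c0] alone. *)
Lemma generator_bump_le (c0 : R) : 0 < c0 -> exists2 C : R, 0 < C &
  forall (P : R -> (R -> R) -> R -> R) (p : R -> R -> R[i]) (l sigma : R -> R)
    (nu : R -> {measure set R -> \bar R}) (a r y : R) (f : R -> R),
  is_symbol P p ->
  (forall x, levy_measure (nu x)) ->
  (forall x xi, p x xi = levy_khintchine (l x) (sigma x) (nu x) xi) ->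
  (forall x, sigma x ^+ 2 = 0) ->
  (forall x xi, `|complex.Im (p x xi)| <= c0 * complex.Re (p x xi)) ->
  0 < r -> generator P (bump a r 0) f ->
  `|f y| <= C * fine (pU nu y r^-1).
Proof.
move=> c00; have [K K0 fK] := fourier_bump_le R.
(* [K] is only known to be nonnegative; the summand 1 makes the constant positive. *)
exists (4 * (1 + c0) * K * pi + 1).
  by rewrite ltr_wpDl // !mulr_ge0 ?pi_ge0 // addr_ge0 // ltW.
move=> P p l sigma nu a r y f symb L pE s0 sect r0 gf.
set q := fine _; have q0 : 0 <= q by apply: fine_ge0; exact: pU_ge0.
have pR xi : `|complex.Re (p y xi)| <= 2 * (1 + (r * xi) ^+ 2) * q.
  by rewrite pE; exact: Re_symbol_le.
have pI xi : `|complex.Im (p y xi)| <= c0 * (2 * (1 + (r * xi) ^+ 2) * q).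
  apply: le_trans (sect y xi) _; rewrite ler_pM2l //.
  by apply: le_trans (pR xi); exact: ler_norm.
have -> : f y = - \int[mu]_xi complex.Re (expi (y * xi) * fourier (bump a r 0) xi * p y xi).
  by have /(congr1 (@complex.Re R)) := symb _ _ (Cc_infty_bump a r0) gf y.
rewrite normrN; pose k := 4 * (1 + c0) * K * q.
have k0 : 0 <= k by rewrite !mulr_ge0 // addr_ge0 // ltW.
have den (z : R) : 0 < 1 + (r * z) ^+ 2 by rewrite ltr_pwDl ?sqr_ge0.
have intE : (\int[mu]_xi (k * (r / (1 + (r * xi) ^+ 2)))%:E = (k * pi)%:E)%E.
  rewrite [RHS]EFinM -(integral_oneDsqr_scale r0) -ge0_integralZl_EFin //.
  - by move=> z _; rewrite lee_fin divr_ge0 ?ltW.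
  - apply/measurable_EFinP; apply: continuous_measurable_fun => z.
    apply: cvgM; first exact: cvg_cst.
    apply: cvgV; first by rewrite gt_eqF.
    apply: cvgD; first exact: cvg_cst.
    apply: (@continuous_comp _ _ _ (fun y : R => r * y) (fun y : R => y ^+ 2)).
      exact: mulrl_continuous.
    exact: exprn_continuous.
apply: (@le_trans _ _ (k * pi)); last first.
  have -> : k * pi = 4 * (1 + c0) * K * pi * q by rewrite /k; ring.
  by rewrite ler_wpM2r // lerDl.
rewrite [leRHS](_ : _ = \int[mu]_xi (k * (r / (1 + (r * xi) ^+ 2)))); last first.
  by rewrite /Rintegral intE.
apply: normr_Rintegral_le; last by rewrite intE ltry.
move=> xi _; have [fR fI] := fK a r xi r0.
move: (pR xi) (pI xi) fR fI; rewrite /expi.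
case: (fourier _ _) => u1 u2; case: (p y xi) => v1 v2 /=.
set U := K * r / _; set M := 2 * _ * q => hv1 hv2 hu1 hu2.
have hc : `|cos (y * xi)| <= 1 by rewrite ler_norml cos_geN1 cos_le1.
have hs : `|sin (y * xi)| <= 1 by rewrite ler_norml sin_geN1 sin_le1.
(* Covers both the real and the imaginary part of [expi (y * xi)] times the Fourier transform; they
   multiply the real and the imaginary part of the symbol. *)
have half (c s : R) : `|c| <= 1 -> `|s| <= 1 -> `|c * u1 + s * u2| <= 2 * U.
  move=> c1 s1; apply: le_trans (ler_normD _ _) _; rewrite mulr2n mulrDl mul1r.
  by apply: lerD; rewrite normrM -[leRHS]mul1r ler_pM.
have -> : k * (r / (1 + (r * xi) ^+ 2)) = 2 * U * M + 2 * U * (c0 * M).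
  by rewrite /k /U /M; field; rewrite gt_eqF.
have U0 : 0 <= U by apply: le_trans hu1.
apply: le_trans (ler_normB _ _) _; apply: lerD; rewrite normrM ler_pM //.
  by rewrite -mulNr half ?normrN.
by rewrite addrC half.
Qed.

End generator_bump.

(** * Exit probabilities *)

Section markov.
Context (R : realType) d (Omega : measurableType d).
Variables (X : R -> Omega -> R) (Pr : R -> probability Omega R).
Hypothesis MP : markov_process X Pr.
Import HBNNSimple.
Local Open Scope ereal_scope.

Lemma natural_filtration_measurable (t : R) (A : set Omega) :
  natural_filtration X t A -> measurable A.
Proof.
apply; split; first exact: sigma_algebra_measurable.
move=> _ [r [B [/andP[r0 _] mB ->]]].
by rewrite -[X in measurable X]setTI; apply: (mp_measurable MP r0).
Qed.

Let integral_comp_nnsfun (P : {measure set Omega -> \bar R}) (A : set Omega)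
    (Y : Omega -> R) (h : {nnsfun R >-> R}) :
  measurable A -> measurable_fun setT Y ->
  \int[P]_(w in A) (h (Y w))%:E =
  \sum_(r \in range h) r%:E * P (A `&` Y @^-1` (h @^-1` [set r])).
Proof.
move=> mA mY.
have mhY r : measurable (Y @^-1` (h @^-1` [set r])).
  by rewrite -[X in measurable X]setTI; apply: mY.
under eq_integral do rewrite fimfunE -fsumEFin//.
rewrite ge0_integral_fsum //; last 2 first.
- move=> r; apply/measurable_EFinP; apply: measurable_funM => //.
  by apply: measurableT_comp => //; exact: measurable_funTS.
- by move=> r w _; rewrite EFinM nnfun_muleindic_ge0.
apply: eq_fsbigr => r _.
rewrite (@integralZl_indic _ _ _ P A mA (fun r => Y @^-1` (h @^-1` [set r])) r) //.
  by rewrite integral_indic // setIC.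
by move=> r0; rewrite preimage_nnfun0.
Qed.

(** [mp_markov] is the case of indicators. Linearity extends it to simple functions, and monotone
    convergence, first under each law [Pr (X s w)] and then under [Pr x], to nonnegative measurable
    functions. *)
Lemma markov_integral (x s t : R) (A : set Omega) (f : R -> \bar R) :
  (0 <= s)%R -> (0 <= t)%R -> natural_filtration X s A ->
  (forall z, 0 <= f z) -> measurable_fun setT f ->
  \int[Pr x]_(w in A) f (X (s + t)%R w) =
  \int[Pr x]_(w in A) \int[Pr (X s w)]_w' f (X t w').
Proof.
move=> s0 t0 FA f0 mf; have mA := natural_filtration_measurable FA.
pose g := nnsfun_approx measurableT mf.
have gf z : (g n z)%:E @[n --> \oo] --> f z by exact: cvg_nnsfun_approx.
have nd z : nondecreasing_seq (fun n => (g n z)%:E).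
  by move=> m n mn; rewrite lee_fin; exact/lefP/nd_nnsfun_approx.
have comp_cvg (P : {measure set Omega -> \bar R}) (B : set Omega) (Y : Omega -> R) :
    measurable B -> measurable_fun setT Y ->
    \int[P]_(w in B) (g n (Y w))%:E @[n --> \oo] --> \int[P]_(w in B) f (Y w).
  move=> mB mY.
  rewrite (_ : \int[P]_(w in B) f (Y w) =
      \int[P]_(w in B) limn (fun n => (g n (Y w))%:E)); last first.
    by apply: eq_integral => w _; apply/esym/cvg_lim => //; exact: gf.
  apply: cvg_monotone_convergence => //.
  - move=> n; apply/measurable_EFinP; apply: measurableT_comp => //.
    exact: measurable_funTS.
  - by move=> n w _; rewrite lee_fin.
have mXt := mp_measurable MP t0; have mXs := mp_measurable MP s0.
have mXst := mp_measurable MP (addr_ge0 s0 t0).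
have mgn n r : measurable (g n @^-1` [set r]) by [].
have mker n r : measurable_fun setT
    (fun w => Pr (X s w) (X t @^-1` (g n @^-1` [set r]))).
  by apply: (measurableT_comp (mp_kernel MP t0 (mgn n r)) mXs).
have innerE n y : \int[Pr y]_w' (g n (X t w'))%:E =
    \sum_(r \in range (g n)) r%:E * Pr y (X t @^-1` (g n @^-1` [set r])).
  by rewrite integral_comp_nnsfun //; apply: eq_fsbigr => r _; rewrite setTI.
have minner n : measurable_fun setT (fun w => \int[Pr (X s w)]_w' (g n (X t w'))%:E).
  under eq_fun do rewrite innerE.
  by apply: emeasurable_fsum => // r; exact: measurable_funeM.
have step n : \int[Pr x]_(w in A) (g n (X (s + t)%R w))%:E =
    \int[Pr x]_(w in A) \int[Pr (X s w)]_w' (g n (X t w'))%:E.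
  rewrite integral_comp_nnsfun //.
  under [RHS]eq_integral do rewrite innerE.
  rewrite ge0_integral_fsum //; last 2 first.
  - by move=> r; apply: measurable_funTS; exact: measurable_funeM.
  - move=> r w _; apply: (mulemu_ge0 (fun r => X t @^-1` (g n @^-1` [set r]))).
    by move=> r0; rewrite preimage_nnfun0.
  apply: eq_fsbigr => r _; 
  transitivity (r%:E * \int[Pr x]_(w in A) Pr (X s w) (X t @^-1` (g n @^-1` [set r]))).
    by congr (_ * _); exact: mp_markov.
  have [r0|r0] := leP 0%R r.
    by rewrite ge0_integralZl_EFin //; exact: measurable_funTS.
  (* For negative [r] the level set of a nonnegative simple function is empty, and both sides
     vanish. *)
  have Z y : Pr y (X t @^-1` (g n @^-1` [set r])) = 0.
    by rewrite preimage_nnfun0 // preimage_set0 measure0.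
  rewrite [X in _ * X]integral0_eq ?mule0; last by move=> w _; rewrite Z.
  by rewrite [RHS]integral0_eq // => w _; rewrite Z mule0.
apply: (@cvg_unique _ (@ereal_hausdorff R) _ _ _ _ (comp_cvg _ _ _ mA mXst)).
rewrite [X in X @ _](_ : _ = fun n =>
    \int[Pr x]_(w in A) \int[Pr (X s w)]_w' (g n (X t w'))%:E); last first.
  by apply/funext => n; exact: step.
rewrite (_ : (\int[Pr x]_(w in A) _) = \int[Pr x]_(w in A)
    limn (fun n => \int[Pr (X s w)]_w' (g n (X t w'))%:E)); last first.
  by apply: eq_integral => w _; apply/esym/cvg_lim => //; exact: comp_cvg.
apply: cvg_monotone_convergence => //.
- by move=> n; exact: measurable_funTS.
- by move=> n w _; apply: integral_ge0 => w' _; rewrite lee_fin.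
- move=> w _ m n mn; apply: ge0_le_lower_integral => w' _; first by rewrite lee_fin.
  exact: nd.
Qed.

End markov.

(** * Exit from a ball along a time grid *)

Section discrete_skeleton.
Context (R : realType) d (Omega : measurableType d).
Variables (X : R -> Omega -> R) (Pr : R -> probability Omega R).
Hypothesis feller : feller_process X Pr.
Let MP : markov_process X Pr := feller.1.
Let FS : feller_semigroup (transition X Pr) := feller.2.

Definition stays_in (x r h : R) (n : nat) : set Omega :=
  [set w | forall j, (j <= n)%N -> `|X (j%:R * h) w - x| <= r].

Let measurable_ball (x r : R) : measurable [set y : R | `|y - x| <= r].
Proof.
rewrite (_ : [set y | _] = `[x - r, x + r]%classic); first exact: measurable_itv.
by apply/seteqP; split=> y /=; rewrite in_itv /= ler_distl.
Qed.

Lemma natural_filtration_stays_in (x r h : R) (n : nat) : 0 <= h ->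
  natural_filtration X (n%:R * h) (stays_in x r h n).
Proof.
move=> h0; rewrite -[stays_in _ _ _ _]setCK; apply: sigma_algebraC.
rewrite (_ : ~` _ = \bigcup_j (if (j <= n)%N then
    X (j%:R * h) @^-1` ~` [set y | `|y - x| <= r] else set0)).
  apply: sigma_algebra_bigcup => j; case: ifPn => jn; last exact: sigma_algebra0.
  apply: sub_gen_smallest; exists (j%:R * h), (~` [set y | `|y - x| <= r]).
  split=> //; last by apply: measurableC; exact: measurable_ball.
  by rewrite mulr_ge0 //= ler_wpM2r // ler_nat.
apply/seteqP; split=> w /=.
  by move=> /existsNP[j /not_implyP[jn jr]]; exists j => //; rewrite jn.
by move=> [j _]; case: ifPn => // jn jr /(_ j jn).
Qed.

Lemma measurable_stays_in (x r h : R) (n : nat) : 0 <= h ->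
  measurable (stays_in x r h n).
Proof.
by move=> h0; apply: (natural_filtration_measurable MP); exact: natural_filtration_stays_in.
Qed.

Variables (x r h K : R) (u : R -> R).
Hypotheses (h0 : 0 <= h) (K0 : 0 <= K) (uC : C_infty u).
Hypotheses (u01 : forall y, 0 <= u y <= 1) (ux : u x = 1) (r0 : 0 <= r).
Hypothesis u_out : forall y, r < `|y - x| -> u y = 0.
Hypothesis drift : forall y, `|y - x| <= r -> u y - transition X Pr h u y <= K.

Let D := stays_in x r h.
Let mD n : measurable (D n). Proof. exact: measurable_stays_in. Qed.

Local Open Scope ereal_scope.

Let u_ge0 y : (0 <= u y)%R. Proof. by have /andP[] := u01 y. Qed.
Let u_le1 y : (u y <= 1)%R. Proof. by have /andP[] := u01 y. Qed.

Let mu_ : measurable_fun setT u.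
Proof. by apply: continuous_measurable_fun; have [] := uC. Qed.

Let transitionE y : \int[Pr y]_w (u (X h w))%:E = (transition X Pr h u y)%:E.
Proof.
rewrite /transition /Rintegral fineK // ge0_fin_numE.
  apply: (@le_lt_trans _ _ (\int[Pr y]_w (cst 1 w))).
    by apply: ge0_le_lower_integral => w _; rewrite lee_fin.
  rewrite integral_cst // mul1e; apply: (@le_lt_trans _ _ 1); last exact: ltry.
  exact: probability_le1.
by apply: integral_ge0 => w _; rewrite lee_fin.
Qed.

(* [W n] loses at most [K] in each step because [u] vanishes outside the ball, so
   that [D n.+1] may be replaced by [D n] before using the Markov property. *)
Let W n := \int[Pr x]_(w in D n) (u (X (n%:R * h)%R w))%:E.

Let mX n : measurable_fun setT (X (n%:R * h)%R).
Proof. by apply: (mp_measurable MP); exact: mulr_ge0. Qed.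

Let W0 : 1 <= W 0.
Proof.
have m0 : measurable (X 0 @^-1` [set x]).
  by rewrite -[X in measurable X]setTI; apply: (mp_measurable MP (lexx 0)).
have P0 : Pr x (X 0 @^-1` [set x]) = 1 by exact: mp_start.
have -> : 1 = \int[Pr x]_(w in X 0 @^-1` [set x]) (u (X (0%:R * h)%R w))%:E.
  rewrite -[LHS]P0 -[LHS]mul1e -integral_cst //.
  by apply: eq_integral => w /set_mem /= Xw; rewrite mul0r Xw ux.
apply: ge0_subset_integral => //.
- by apply/measurable_EFinP; apply: measurableT_comp => //; exact: measurable_funTS.
- by move=> w _; rewrite lee_fin.
- by move=> w /= Xw j; rewrite leqn0 => /eqP ->; rewrite mul0r Xw subrr normr0.
Qed.

Let WS n : W n <= W n.+1 + K%:E.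
Proof.
have -> : W n.+1 = \int[Pr x]_(w in D n) (u (X (n.+1%:R * h)%R w))%:E.
  rewrite /W [LHS]integral_mkcond [RHS]integral_mkcond; apply: eq_integral => w _.
  rewrite !patchE; case: ifPn => [/set_mem Dw|Dw]; first rewrite mem_set //.
    by move=> j jn; apply: Dw; exact: leqW.
  case: ifPn => // /set_mem Dw'; rewrite u_out // ltNge; apply/negP => Xw.
  move/negP : Dw; apply; apply/mem_set => j.
  by rewrite leq_eqVlt => /predU1P[->//|]; exact: Dw'.
have -> : \int[Pr x]_(w in D n) (u (X (n.+1%:R * h)%R w))%:E =
    \int[Pr x]_(w in D n) (transition X Pr h u (X (n%:R * h)%R w))%:E.
  rewrite -natr1 mulrDl mul1r.
  rewrite (@markov_integral _ _ _ _ _ MP _ _ _ _ (fun y => (u y)%:E)) //.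
  - by apply: eq_integral => w _; exact: transitionE.
  - exact: mulr_ge0.
  - exact: natural_filtration_stays_in.
  - exact/measurable_EFinP.
have mT : measurable_fun setT (transition X Pr h u).
  by apply: continuous_measurable_fun; have [] := fs_C_infty FS h0 uC.
have T0 y : (0 <= transition X Pr h u y)%R.
  by apply: fine_ge0; apply: integral_ge0 => w _; rewrite lee_fin.
have mTX : measurable_fun (D n) (fun w => (transition X Pr h u (X (n%:R * h)%R w))%:E).
  by apply/measurable_EFinP; apply: measurableT_comp => //; exact: measurable_funTS.
apply: (@le_trans _ _ (\int[Pr x]_(w in D n)
    ((transition X Pr h u (X (n%:R * h)%R w))%:E + K%:E))).
  apply: ge0_le_lower_integral => w Dw; first by rewrite lee_fin.
  by rewrite -EFinD lee_fin addrC -lerBlDr; apply: drift; exact: Dw.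
rewrite ge0_integralD //; last by move=> w _; rewrite lee_fin.
rewrite leeD2l // integral_cst // -[leRHS]mule1.
by apply: lee_wpmul2l; [rewrite lee_fin | exact: probability_le1].
Qed.

(** Telescoping [WS] from [W0] gives 1 <= W n + n K, and W n is at most the probability of [D n]
    because [u] is at most 1. *)
Lemma stays_in_prob (n : nat) : Pr x (~` D n) <= (n%:R * K)%:E.
Proof.
have W1 : 1 <= W n + (n%:R * K)%:E.
  elim: n => [|n IH]; first by rewrite mul0r adde0.
  apply: le_trans IH _; rewrite -natr1 mulrDl mul1r EFinD addeA addeAC.
  by rewrite leeD2r.
have WD : W n <= Pr x (D n).
  rewrite -[leRHS]mul1e -integral_cst //.
  by apply: ge0_le_lower_integral => w _; rewrite lee_fin.
rewrite probability_setC //; rewrite leeBlDl ?fin_num_measure //.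
by apply: le_trans W1 _; rewrite leeD2r.
Qed.

End discrete_skeleton.

Lemma dyadic_small (R : realType) (t e : R) : 0 <= t -> 0 < e ->
  exists M, forall m, (M <= m)%N -> t / (2 ^ m)%:R < e.
Proof.
move=> t0 e0; exists (Num.truncn (t / e)).+1 => m Mm.
rewrite ltr_pdivrMr ?ltr0n ?expn_gt0 // mulrC -ltr_pdivrMr //.
have /andP[_ /lt_le_trans] := truncn_itv (divr_ge0 t0 (ltW e0)); apply.
by rewrite ler_nat (leq_trans Mm) // ltnW // ltn_expl.
Qed.

(** * From dyadic grids to continuous time *)

Section maximal_inequality.
Context (R : realType) d (Omega : measurableType d).
Variables (X : R -> Omega -> R) (Pr : R -> probability Omega R).
Hypothesis feller : feller_process X Pr.
Let MP : markov_process X Pr := feller.1.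

Let two_gt0 m : 0 < (2 ^ m)%:R :> R. Proof. by rewrite ltr0n expn_gt0. Qed.

Definition dyadic_stays_in (x r t : R) (m : nat) : set Omega :=
  stays_in X x r (t / (2 ^ m)%:R) (2 ^ m)%N.

(** If the path is outside the closed ball at some s < t, right continuity keeps it outside on an
    interval to the right of s, and a fine enough dyadic grid has a point there. *)
Lemma dyadic_stays_in_path (x r t : R) (w : Omega) : 0 < t ->
  (forall m, dyadic_stays_in x r t m w) ->
  forall s, 0 <= s <= t -> `|X s w - x| <= r.
Proof.
move=> t0 Dw s /andP[s0]; rewrite le_eqVlt => /predU1P[->|st].
  (* The endpoint [t] is itself a grid point at level 0. *)
  by have := Dw 0%N 1%N (leqnn _); rewrite expn0 divr1 mul1r.
rewrite leNgt; apply/negP => Xr.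
have [cr _] := mp_cadlag MP w.
have : \forall q \near s^'+, r < `|X q w - x|.
  by apply: (cvgr_gt `|X s w - x|) => //; apply: cvg_norm; apply: cvgB; [exact: cr|exact: cvg_cst].
move=> [e /= e0 He].
have [m /(_ m (leqnn m)) hm] := dyadic_small (ltW t0) e0.
set h := t / _ in hm; have h0 : 0 < h by rewrite divr_gt0.
(* First grid index strictly after [s], since the right neighbourhood excludes [s] itself. *)
set j := (Num.truncn (s / h)).+1.
have /andP[j1 j2] := truncn_itv (divr_ge0 s0 (ltW h0)).
rewrite ler_pdivlMr // in j1; rewrite ltr_pdivrMr // -/j in j2.
have jE : j%:R * h = (Num.truncn (s / h))%:R * h + h by rewrite /j -natr1 mulrDl mul1r.
have jm : (j <= 2 ^ m)%N.
  rewrite /j -(ltr_nat R) -(ltr_pM2r h0); apply: le_lt_trans j1 _.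
  by rewrite /h mulrC divfK ?gt_eqF.
suff /He /(_ j2) : ball_ Num.norm s e (j%:R * h) by rewrite ltNge (Dw m j jm).
by rewrite /= ltr0_norm ?subr_lt0 // opprB jE; lra.
Qed.

Let dyadic_nonincr (x r t : R) : 0 <= t ->
  {homo dyadic_stays_in x r t : m n / (m <= n)%N >-> n `<=` m}.
Proof.
move=> t0 m n mn w Dw j jm.
have := Dw (j * 2 ^ (n - m))%N; rewrite -[in X in (_ <= X)%N](subnKC mn) expnD leq_mul2r jm orbT.
rewrite -{2}(subnKC mn) expnD !natrM => /(_ isT).
rewrite (_ : j%:R * _ * _ = j%:R * (t / (2 ^ m)%:R)) //.
by field; rewrite !gt_eqF.
Qed.

Let measurable_dyadic (x r t : R) m : 0 <= t -> measurable (dyadic_stays_in x r t m).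
Proof. by move=> t0; apply: (measurable_stays_in feller); rewrite divr_ge0. Qed.

(** A countable union over grids, hence measurable. By [not_leaves] it contains, for t > 0, every
    path that is farther than [r] from [x] at some time in [0, t], and so stands in for the event
    about the supremum. *)
Definition leaves (x r t : R) : set Omega :=
  \bigcup_m ~` dyadic_stays_in x r t m.

Lemma measurable_leaves (x r t : R) : 0 <= t -> measurable (leaves x r t).
Proof.
by move=> t0; apply: bigcup_measurable => m _; apply: measurableC; exact: measurable_dyadic.
Qed.

Lemma not_leaves (x r t : R) (w : Omega) : 0 < t -> ~ leaves x r t w ->
  forall s, 0 <= s <= t -> `|X s w - x| <= r.
Proof.
move=> t0 Lw; apply: dyadic_stays_in_path => // m.
by apply: contrapT => Dw; apply: Lw; exists m.
Qed.

(** The difference quotients converge to [f] uniformly, so for small h the drop of [u] in one step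
    is at most h (g + e / t) everywhere on the ball. Over 2^m steps of length t / 2^m the total is t
    g + e. The exit events increase with m, so the bound passes to their union. *)
Lemma leaves_prob_le (x r t g : R) (u f : R -> R) : 0 < t -> 0 < r -> 0 <= g ->
  generator (transition X Pr) u f ->
  (forall y, 0 <= u y <= 1) -> u x = 1 -> (forall y, r < `|y - x| -> u y = 0) ->
  (forall y, `|y - x| <= r -> `|f y| <= g) ->
  (Pr x (leaves x r t) <= (t * g)%:E)%E.
Proof.
move=> t0 r0 g0 [uC fC gen] u01 ux u_out fg.
apply/lee_addgt0Pr => e e0.
have /fine_cvgP[fin_near cv] := gen.
have e1 : 0 < e / t by rewrite divr_gt0.
have lt_near := cvgr_lt _ cv _ e1.
have : \forall h \near 0^'+, forall y, `|y - x| <= r ->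
    u y - transition X Pr h u y <= h * (g + e / t).
  near=> h => y yr.
  have h0 : 0 < h by near: h; exact: nbhs_right_gt.
  set P := transition X Pr h u y.
  have : `|(P - u y) / h - f y| < e / t.
    rewrite -lte_fin; apply: (@le_lt_trans _ _ (sup_norm
      (fun z => (transition X Pr h u z - u z) / h - f z))).
      by apply: ereal_sup_ubound; exists y.
    have fin : sup_norm (fun z => (transition X Pr h u z - u z) / h - f z)
        \is a fin_num by near: h; exact: fin_near.
    rewrite -(fineK fin) lte_fin; near: h; exact: lt_near.
  have := fg y yr; rewrite ler_norml ltr_norml => /andP[f1 _] /andP[f2 _].
  have : - (g + e / t) <= (P - u y) / h by lra.
  by rewrite ler_pdivlMr //; lra.
move=> [q /= q0 Hq]; have [M HM] := dyadic_small (ltW t0) q0.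
have mono : {homo (fun m => ~` dyadic_stays_in x r t m) : n m / (n <= m)%N >-> (n <= m)%O}.
  by move=> n m nm; apply/subsetPset; apply: subsetC; exact: dyadic_nonincr (ltW t0) _ _ nm.
have cvP := @nondecreasing_cvg_mu _ _ _ (Pr x) (fun m => ~` dyadic_stays_in x r t m)
  (fun m => measurableC (measurable_dyadic x r m (ltW t0)))
  (measurable_leaves x r (ltW t0)) mono.
rewrite /leaves -(cvg_lim _ cvP) //.
apply: lime_le; first by apply/cvg_ex; eexists; exact: cvP.
exists M => // m /= Mm.
have h0 : 0 < t / (2 ^ m)%:R by rewrite divr_gt0.
have -> : ((t * g)%:E + e%:E)%E =
    ((2 ^ m)%:R * (t / (2 ^ m)%:R * (g + e / t)))%:E.
  by rewrite -EFinD; congr EFin; field; rewrite !gt_eqF.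
apply: (@stays_in_prob _ _ _ _ _ feller x r _ _ u) => //.
- exact: ltW.
- by rewrite !mulr_ge0 ?addr_ge0 ?divr_ge0 ?(ltW t0) ?(ltW e0).
- exact: ltW.
- by move=> y yr; apply: Hq => //=; rewrite sub0r normrN gtr0_norm // HM.
Unshelve. all: by end_near. Qed.

End maximal_inequality.

(** * Summability and the small-time limit *)

(** With t_n = e / 2^n, the intervals ]t_(n+2), t_(n+1)] are disjoint of length t_n / 4, and on the
    n-th one [f] is at least a_n / (c t_n). Hence the series is at most 4 c times the integral of
    [f]. Only step functions below [f] are integrated term by term, so [f] may fail to be
    measurable. *)
Lemma series_leaves_lt_pinfty (R : realType) (a : nat -> \bar R) (f : R -> \bar R)
    (e c : R) :
  0 < e -> 0 < c -> (forall n, (0 <= a n)%E) ->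
  (forall t, 0 < t < e -> (0 <= f t)%E) ->
  (\int[lebesgue_measure]_(t in `]0%R, e[) f t < +oo)%E ->
  (forall n s, e / (2 ^ n.+2)%:R < s -> s <= e / (2 ^ n.+1)%:R ->
    (a n <= (c * (e / (2 ^ n)%:R))%:E * f s)%E) ->
  (\sum_(n <oo) a n < +oo)%E.
Proof.
move=> e0 c0 a0 f0 foo af.
pose t n : R := e / (2 ^ n)%:R.
have two_gt0 n : 0 < (2 ^ n)%:R :> R by rewrite ltr0n expn_gt0.
have t0 n : 0 < t n by rewrite divr_gt0.
have tS n : t n = 2 * t n.+1 by rewrite /t expnS natrM; field; rewrite gt_eqF.
pose b n : \bar R := ((c * t n)^-1%:E * a n)%E.
have b0 n : (0 <= b n)%E by rewrite mule_ge0 // lee_fin invr_ge0 mulr_ge0 ?ltW.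
pose D : set R := `]0%R, e[%classic.
pose step n (s : R) : \bar R := (b n * (\1_(`]t n.+2, t n.+1]%classic) s)%:E)%E.
have mstep n (E : set R) : measurable_fun E (step n).
  by apply: measurable_funeM; apply/measurable_EFinP; exact: measurable_funTS.
have step0 n s : (0 <= step n s)%E by rewrite mule_ge0 // lee_fin.
(* The second claim carries the disjointness through the induction: where step [N] is nonzero, all
   earlier steps vanish. *)
have below N s : D s -> (\sum_(n < N) step n s <= f s)%E /\
    (s <= t N.+1 -> (\sum_(n < N) step n s = 0)%E).
  rewrite /D /= in_itv /= => se; elim: N => [|N [IH1 IH2]].
    by rewrite big_ord0; split => //; exact: f0.
  rewrite big_ord_recr /= [step N s]/step indicE; case: (boolP (_ \in _)) => [|sN]; last first.
    rewrite mule0 adde0; split=> // sN2; apply: IH2; apply: le_trans sN2 _.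
    rewrite [t N.+1]tS. by rewrite ler_peMl ?ler1n // ltW.
  move=> /set_mem; rewrite /= in_itv /= => /andP[s1 s2].
  rewrite IH2 // add0e mule1; split; last by rewrite leNgt s1.
  by rewrite /b lee_pdivrMl ?mulr_gt0 //; exact: af.
have mD : measurable (D : set R) by exact: measurable_itv.
have mI n : measurable (`]t n.+2, t n.+1]%classic : set R) by exact: measurable_itv.
have muI n : lebesgue_measure (`]t n.+2, t n.+1]%classic `&` D) = (t n / 4)%:E.
  rewrite setIidl; last first.
    move=> s; rewrite /D /= !in_itv /= => /andP[s1 s2].
    rewrite (lt_trans _ s1) //= (le_lt_trans s2) // /t ltr_pdivrMr //.
    by rewrite ltr_pMr // ltr1n -[1%N](expn0 2) ltn_exp2l.
  rewrite lebesgue_measure_itv /= lte_fin (tS n) (tS n.+1).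
  by rewrite ltr_pMl ?ltr1n // -EFinB; congr EFin; field.
have partial N : (\sum_(n < N) a n <= (4 * c)%:E * \int[lebesgue_measure]_(s in D) f s)%E.
  apply: (@le_trans _ _ ((4 * c)%:E *
      \int[lebesgue_measure]_(s in D) \sum_(n < N) step n s)%E); last first.
    apply: lee_wpmul2l; first by rewrite lee_fin mulr_ge0 // ltW.
    apply: ge0_le_lower_integral => s Ds; last by have [] := below N s Ds.
    by apply: sume_ge0 => n _; exact: step0.
  rewrite ge0_integral_sum //; last by move=> n; exact: mstep.
  rewrite ge0_sume_distrr; last by move=> n _; apply: integral_ge0 => s _; exact: step0.
  apply: lee_sum => n _; rewrite /step ge0_integralZl //; last first.
    by apply/measurable_EFinP; exact: measurable_funTS.
  have -> : (\int[lebesgue_measure]_(s in D) (\1_(`]t n.+2, t n.+1]%classic) s)%:E =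
      (t n / 4)%:E)%E.
    by rewrite integral_indic //; exact: muI.
  rewrite [(b n * _)%E]muleC muleA -EFinM /b muleA -EFinM (_ : _ * _ = 1) ?mul1e //.
  by field; rewrite !gt_eqF.
apply: (@le_lt_trans _ _ ((4 * c)%:E * \int[lebesgue_measure]_(s in D) f s)%E).
  apply: lime_le; first exact: is_cvg_nneseries.
  by apply: nearW => N; rewrite big_mkord; exact: partial.
by apply: lte_mul_pinfty => //; rewrite lee_fin mulr_ge0 // ltW.
Qed.

Section exit_estimate.
Context (R : realType) (d : measure_display) (Omega : measurableType d).
Variables (X : R -> Omega -> R) (Pr : R -> probability Omega R).
Variables (p : R -> R -> R[i]) (l sigma : R -> R).
Variables (nu : R -> {measure set R -> \bar R}) (c0 : R).
Hypotheses (feller : feller_process X Pr)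
  (domain : forall u, Cc_infty u -> generator_domain (transition X Pr) u)
  (symbol : is_symbol (transition X Pr) p)
  (levy : forall x, levy_measure (nu x))
  (p_form : forall x xi, p x xi = levy_khintchine (l x) (sigma x) (nu x) xi)
  (no_diffusion : forall x, sigma x ^+ 2 = 0)
  (c0_gt0 : 0 < c0)
  (sector : forall x xi, `|complex.Im (p x xi)| <= c0 * complex.Re (p x xi)).

Definition sup_pU (x r xi : R) : \bar R :=
  ereal_sup [set pU nu y xi | y in [set y | `|y - x| <= r]].

Lemma sup_pU_ge0 (x r xi : R) : 0 <= r -> (0 <= sup_pU x r xi)%E.
Proof.
move=> r0; apply: le_trans (pU_ge0 nu x xi) _; apply: ereal_sup_ubound.
by exists x => //=; rewrite subrr normr0.
Qed.

(** The maximal inequality: [leaves_prob_le] for the bump of radius [r] about [x], with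
    [generator_bump_le] bounding the generator on the ball. *)
Lemma leaves_prob_sup_pU : exists2 C : R, 0 < C & forall x r t, 0 < r -> 0 < t ->
  (Pr x (leaves X x r t) <= (C * t)%:E * sup_pU x r r^-1)%E.
Proof.
have [C C0 genC] := generator_bump_le c0_gt0.
exists C => // x r t r0 t0; have Ct0 : 0 < C * t by exact: mulr_gt0.
(* An infinite supremum makes the bound trivial; a finite one can be used as a real number. *)
have [Goo|Gfin] := eqVneq (sup_pU x r r^-1) +oo%E.
  by rewrite Goo gt0_muley ?lte_fin ?leey.
have {}Gfin : sup_pU x r r^-1 \is a fin_num.
  by rewrite ge0_fin_numE ?sup_pU_ge0 ?(ltW r0) // lt_neqAle Gfin leey.
have [f gf] := domain (Cc_infty_bump x r0).
rewrite -(fineK Gfin) -EFinM [C * t]mulrC -mulrA.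
apply: (leaves_prob_le feller t0 r0 _ gf) => [||||y yr].
- by rewrite mulr_ge0 ?(ltW C0) // fine_ge0 // sup_pU_ge0 // ltW.
- exact: bump_itv.
- exact: bump_center.
- by move=> y yr; rewrite bump_eq0 // ltW.
- have pfin : pU nu y r^-1 \is a fin_num by rewrite ge0_fin_numE ?pU_ge0 // pU_lt_pinfty.
  apply: le_trans (genC _ _ _ _ _ _ _ y _ symbol levy p_form no_diffusion sector r0 gf) _.
  rewrite ler_pM2l // fine_le //.
  by apply: ereal_sup_ubound; exists y.
Qed.

End exit_estimate.

Lemma sup_pU_dilate (R : realType) (nu : R -> {measure set R -> \bar R}) (x e r : R) :
  0 < e -> e <= 1 -> 0 < r ->
  (sup_pU nu x (e * r) (e * r)^-1 <= (e ^- 2)%:E * sup_pU nu x r r^-1)%E.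
Proof.
move=> e0 e1 r0; apply: ge_ereal_sup => _ [y /= yr <-].
apply: le_trans (pU_dilate nu y e0 e1 r0) _.
apply: lee_wpmul2l; first by rewrite lee_fin invr_ge0 exprn_ge0 // ltW.
apply: ereal_sup_ubound; exists y => //=; apply: le_trans yr _.
by rewrite ler_piMl // ltW.
Qed.

Lemma subset_leaves (R : realType) d (Omega : measurableType d) (X : R -> Omega -> R)
    (x r r' t : R) : r <= r' -> leaves X x r' t `<=` leaves X x r t.
Proof.
move=> rr w [m _ Dw]; exists m => // Dw'; apply: Dw => j jm.
exact: le_trans (Dw' j jm) rr.
Qed.

Lemma cvge0_norm_le (R : realType) (T : Type) (F : set_system T) (f : T -> \bar R) :
  Filter F -> (forall e : R, 0 < e -> \forall t \near F, (`|f t| <= e%:E)%E) ->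
  f t @[t --> F] --> 0%E.
Proof.
move=> FF fe; apply/fine_cvgP; split.
  apply: filterS (fe 1 ltr01) => t; rewrite fin_num_abs.
  by move/le_lt_trans; apply; exact: ltry.
apply/cvgr0Pnorm_le => e /fe; apply: filterS => t ft /=.
have tfin : f t \is a fin_num.
  by rewrite fin_num_abs; apply: le_lt_trans ft _; exact: ltry.
by rewrite -lee_fin -abse_EFin (fineK tfin).
Qed.

Lemma dyadic_scale_exists (R : realType) (e t : R) : 0 < t -> t <= e ->
  exists n, e / (2 ^ n.+1)%:R < t <= e / (2 ^ n)%:R.
Proof.
move=> t0 te; have e0 : 0 < e by exact: lt_le_trans te.
have ex : exists n, e / (2 ^ n)%:R < t.
  by have [M /(_ M (leqnn M)) ?] := dyadic_small (ltW e0) t0; exists M.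
case: (ex_minnP ex) => -[|n] nt min_n.
  by move: nt; rewrite expn0 divr1 ltNge te.
exists n; rewrite nt leNgt; apply/negP => /min_n; by rewrite ltnn.
Qed.

Theorem proposition9 (R : realType) (d : measure_display)
    (Omega : measurableType d)
    (X : R -> Omega -> R) (Pr : R -> probability Omega R)
    (p : R -> R -> R[i])
    (l sigma : R -> R) (nu : R -> {measure set R -> \bar R})
    (c0 : R) (v : R -> R -> R)
    (feller : feller_process X Pr)
    (domain : forall u, Cc_infty u -> generator_domain (transition X Pr) u)
    (symbol : is_symbol (transition X Pr) p)
    (sigma_ge0 : forall x, 0 <= sigma x)
    (levy : forall x, levy_measure (nu x))
    (p_form : forall x xi, p x xi = levy_khintchine (l x) (sigma x) (nu x) xi)
    (p_cont : forall xi, continuous (fun x => p x xi : R[i]^o))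
    (no_diffusion : forall x, sigma x ^+ 2 = 0)
    (c0_gt0 : 0 < c0)
    (sector : forall x xi,
      `|complex.Im (p x xi)| <= c0 * complex.Re (p x xi))
    (v_ge0 : forall (x t : R), 0 < t -> 0 <= v x t)
    (v_mono : forall (x s t : R), 0 < s -> s <= t -> v x s <= v x t)
    (x : R)
    (v_int : integrable_at_0 (fun t =>
      ereal_sup [set pU nu y (v x t)^-1 | y in [set y | `|y - x| <= v x t]])) :
  {ae Pr x, forall w : Omega,
    (ereal_sup [set (`|X s w - x|%R)%:E | s in [set s | (0 <= s <= t)%R]]
      * ((v x t)^-1)%:E)%E @[t --> 0^'+] --> 0%E}.
Proof.
have [e e0 foo] := v_int.
pose M w t := ereal_sup [set (`|X s w - x|%R)%:E | s in [set s | (0 <= s <= t)%R]].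
have M0 w t : 0 <= t -> (0 <= M w t)%E.
  move=> t0; apply: (@le_trans _ _ (`|X 0 w - x|)%:E); first by rewrite lee_fin.
  by apply: ereal_sup_ubound; exists 0 => //=; rewrite lexx.
(* If [v x] vanishes at some [t1 > 0], the ratio is [0] on ]0, t1] since [0^-1 = 0]. *)
have [[t1 t10 vt1]|/forall2NP vpos] := pselect (exists2 t, 0 < t & v x t = 0).
  apply: aeW => w; apply: cvg_near_cst; near=> t.
  have t0 : 0 < t by near: t; exact: nbhs_right_gt.
  suff -> : v x t = 0 by rewrite invr0 mule0.
  apply/eqP; rewrite eq_le v_ge0 // andbT -vt1; apply: v_mono => //.
  by near: t; exact: nbhs_right_le.
have {}vpos t : 0 < t -> 0 < v x t.
  move=> t0; rewrite lt0r v_ge0 // andbT; apply/eqP => vt.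
  by have [/negP|] := vpos t; rewrite ?t0.
pose t_ n : R := e / (2 ^ n)%:R.
have two_gt0 n : 0 < (2 ^ n)%:R :> R by rewrite ltr0n expn_gt0.
have t0 n : 0 < t_ n by rewrite divr_gt0.
(* A sequence of tolerances tending to 0, so that countably many null sets suffice. *)
pose eps (k : nat) : R := k.+1%:R^-1.
have eps0 k : 0 < eps k by rewrite invr_gt0.
have eps1 k : eps k <= 1 by rewrite invf_le1 // ler1n.
have [C C0 leavesC] := leaves_prob_sup_pU feller domain symbol levy p_form
  no_diffusion c0_gt0 sector.
(* For t in ]t_(n+1), t_n] the running supremum is at most its value at t_n, while v(x, t) is at
   least v(x, t_(n+1)); hence the two different indices. *)
pose Bad k n := leaves X x (eps k * v x (t_ n.+1)) (t_ n).
have mBad k n : measurable (Bad k n) by exact: (measurable_leaves feller _ _ (ltW (t0 n))).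
have BC k : Pr x (lim_sup_set (Bad k)) = 0%E.
  apply: lim_sup_set_cvg0 => //.
  apply: (@series_leaves_lt_pinfty R _
    (fun t => sup_pU nu x (v x t) (v x t)^-1) e (C * eps k ^- 2)) => //.
  - by rewrite mulr_gt0 // invr_gt0 exprn_gt0.
  - by move=> t /andP[tp _]; apply: sup_pU_ge0; exact: v_ge0.
  - move=> n s s1 s2.
    have s0 : 0 < s by exact: lt_trans (t0 n.+2) s1.
    have ev : 0 < eps k * v x s by apply: mulr_gt0; [exact: eps0|exact: vpos].
    (* As s <= t_(n+1), monotonicity of [v] makes the radius smaller and the event larger. The
       radius now matches the integrand at [s]. *)
    apply: (@le_trans _ _ (Pr x (leaves X x (eps k * v x s) (t_ n)))).
      apply: le_measure; rewrite ?inE //; first exact: (measurable_leaves feller _ _ (ltW (t0 n))).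
      by apply: subset_leaves; rewrite ler_pM2l //; exact: v_mono.
    apply: le_trans (leavesC x _ _ ev (t0 n)) _.
    rewrite [in leRHS]mulrAC [in leRHS]EFinM -muleA; apply: lee_wpmul2l.
      by rewrite lee_fin mulr_ge0 ?ltW.
    by apply: sup_pU_dilate => //; exact: vpos.
have : {ae Pr x, forall w, forall k, ~ lim_sup_set (Bad k) w}.
  apply/ae_foralln => k; exists (lim_sup_set (Bad k)); split.
  - apply: bigcapT_measurable => n; apply: bigcup_measurable => j _; exact: mBad.
  - exact: BC.
  - by move=> w /=; exact: contrapT.
apply: filterS => w good; apply: cvge0_norm_le => a a0.
have [k ka] : exists k, eps k <= a.
  (* The integer part of 1 / a, plus one, exceeds 1 / a. *)
  exists (Num.truncn a^-1); rewrite /eps -[leRHS]invrK lef_pV2 ?posrE ?invr_gt0 //.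
  have /andP[_ /ltW] := truncn_itv (ltW (etrans (invr_gt0 a) a0)).
  exact.
have [N Ngood] : exists N, forall n, (N <= n)%N -> ~ Bad k n w.
  have /existsNP[N NN] := good k; exists N => n Nn Bw.
  by apply: NN => _; exists n.
near=> t.
have tp : 0 < t by near: t; exact: nbhs_right_gt.
have tN : t <= t_ N by near: t; exact: nbhs_right_le.
have te : t <= e.
  apply: le_trans tN _; rewrite /t_ ler_pdivrMr // ler_peMr ?(ltW e0) //.
  by rewrite ler1n expn_gt0.
have [n /andP[n1 n2]] := dyadic_scale_exists tp te.
have Nn : (N <= n)%N.
  have : t_ n.+1 < t_ N by exact: lt_le_trans n1 tN.
  by rewrite /t_ ltr_pM2l // ltf_pV2 ?posrE // ltr_nat ltn_exp2l.
have Mt : (M w t <= (eps k * v x t)%:E)%E.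
  apply: ge_ereal_sup => _ [s /= /andP[s0 st] <-]; rewrite lee_fin.
  apply: (@le_trans _ _ (eps k * v x (t_ n.+1))); last first.
    by rewrite ler_pM2l //; apply: v_mono => //; exact: ltW.
  apply: (not_leaves feller (t0 n) (Ngood n Nn)).
  by rewrite s0 (le_trans st).
have vi : 0 < (v x t)^-1 by rewrite invr_gt0 vpos.
rewrite gee0_abs; last by rewrite mule_ge0 ?M0 ?lee_fin ?ltW.
apply: le_trans (lee_wpmul2r _ Mt) _; first by rewrite lee_fin ltW.
by rewrite -EFinM lee_fin mulfK // gt_eqF // vpos.
Unshelve. all: by end_near. Qed.
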